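(* Let $t$ be a domino tiling of the infinite square lattice $\mathbb{Z}^2$. Then exactly one of the following applies: (1) $t$ admits a flip; (2) $t$ consists entirely of parallel, doubly-infinite domino staircases; (3) $t$ is a windmill tiling.
   Context: A domino is the union of two unit squares $[i,i+1]\times[j,j+1]$ ($i,j\in\mathbb{Z}$) sharing a side; it is horizontal or vertical. A tiling of $\mathbb{Z}^2$ is a set of dominoes with pairwise disjoint interiors covering $\mathbb{R}^2$. Flip: $t$ admits a flip if two parallel dominoes of $t$ together form a $2\times2$ square (the flip replaces them by the other two-domino tiling of that square). Doubly-infinite domino staircase: a set of dominoes of the form $\{D+k s: k\in\mathbb{Z}\}$ where $D$ is a domino and $s\in\{(1,1),(1,-1)\}$ (so all dominoes are horizontal or all are vertical, and consecutive dominoes touch along exactly one unit edge of their longer sides). Two such staircases are parallel if they have the same $s$. ''$t$ consists entirely of parallel, doubly-infinite domino staircases'' means that the set of dominoes of $t$ is a disjoint union of doubly-infinite domino staircases all having the same $s$ (horizontal and vertical staircases may both occur). Windmill tilings: for a unit square $S=[a,a+1]\times[b,b+1]$ define the cardinal rugged quadrants with tip $S$, together with their (unique) tilings: - north $N(S)=\bigcup_{i\in\mathbb{Z}}[a+i,a+i+1]\times[b+|i|,\infty)$, tiled by the vertical dominoes $[a+i,a+i+1]\times[b+|i|+2k,b+|i|+2k+2]$, $i\in\mathbb{Z}$, $k\ge0$; - south: the region and tiling obtained from the north quadrant $N(S)$ by the reflection $y\mapsto 2b+1-y$ (vertical dominoes, tip $S$, opening downward); - east $E(S)=\bigcup_{j\in\mathbb{Z}}[a+|j|,\infty)\times[b+j,b+j+1]$,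 tiled by the horizontal dominoes $[a+|j|+2k,a+|j|+2k+2]\times[b+j,b+j+1]$, $j\in\mathbb{Z}$, $k\ge 0$; - west: the region and tiling obtained from the east quadrant $E(S)$ by the reflection $x\mapsto 2a+1-x$ (horizontal dominoes, tip $S$, opening to the left). A windmill tiling is a tiling of $\mathbb{Z}^2$ which, for some point $p\in\mathbb{Z}^2$, is the union of the tilings of four cardinal rugged quadrants, one of each kind, whose tips are the four unit squares around $p$, in one of the following two arrangements: (i) north tip = upper-left square, east tip = upper-right square, south tip = lower-right square, west tip = lower-left square; (ii) north tip = upper-right square, east tip = lower-right square, south tip = lower-left square, west tip = upper-left square. (In each arrangement the four quadrants have disjoint interiors and cover the plane.) *)

(* Defs.v *)
(* Stdlib world: Z for lattice coordinates, R * R for the plane; Coquelicot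
   supplies the product topology on R * R. *)
From Stdlib Require Import Reals ZArith Lra Lia.
From Coquelicot Require Import Coquelicot.

Open Scope Z_scope.

Definition plane : Type := (R * R)%type.

Definition unit_square (i j : Z) (p : plane) : Prop :=
  (IZR i <= fst p <= IZR (i + 1))%R /\ (IZR j <= snd p <= IZR (j + 1))%R.

Inductive orientation : Set := Horizontal | Vertical.

(* A domino is encoded by its orientation and its lower-left lattice point;
   the encoding is a bijection, so Leibniz equality of codes is equality of
   dominoes. *)
Record domino : Set := Domino { dir : orientation; left : Z; bottom : Z }.

Definition region (d : domino) (p : plane) : Prop :=
  let (o, i, j) := d in
  match o with
  | Horizontal => unit_square i j p \/ unit_square (i + 1) j p
  | Vertical => unit_square i j p \/ unit_square i (j + 1) p
  end.

(* [locally p A] says that A is a neighbourhood of p. *)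
Definition plane_interior (A : plane -> Prop) (p : plane) : Prop :=
  locally p A.

Definition is_tiling (t : domino -> Prop) : Prop :=
  (forall d e : domino, t d -> t e -> d <> e ->
     ~ exists p : plane,
         plane_interior (region d) p /\ plane_interior (region e) p) /\
  (forall p : plane, exists d : domino, t d /\ region d p).

Definition admits_flip (t : domino -> Prop) : Prop :=
  exists d e : domino,
    t d /\ t e /\ dir d = dir e /\
    exists a b : Z, forall p : plane,
      (region d p \/ region e p) <->
      ((IZR a <= fst p <= IZR (a + 2))%R /\ (IZR b <= snd p <= IZR (b + 2))%R).

Definition translate (d : domino) (v : Z * Z) : domino :=
  Domino (dir d) (left d + fst v) (bottom d + snd v).

Definition is_staircase (s : Z * Z) (A : domino -> Prop) : Prop :=
  exists D : domino, forall d : domino,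
    A d <-> exists k : Z, d = translate D (k * fst s, k * snd s).

Definition consists_of_parallel_staircases (t : domino -> Prop) : Prop :=
  exists s : Z * Z, (s = (1, 1) \/ s = (1, -1)) /\
  exists F : (domino -> Prop) -> Prop,
    (forall A, F A -> is_staircase s A) /\
    (* distinct members of F are disjoint *)
    (forall A B, F A -> F B -> (exists d, A d /\ B d) ->
       forall d, A d <-> B d) /\
    (forall d, t d <-> exists A, F A /\ A d).

(* The reflection of a domino in the horizontal (resp. vertical) axis of the
   unit square [a, a+1] x [b, b+1]. *)
Definition reflect_y (b : Z) (d : domino) : domino :=
  let (o, i, j) := d in
  match o with
  | Horizontal => Domino Horizontal i (2 * b - j)
  | Vertical => Domino Vertical i (2 * b - 1 - j)
  end.

Definition reflect_x (a : Z) (d : domino) : domino :=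
  let (o, i, j) := d in
  match o with
  | Horizontal => Domino Horizontal (2 * a - 1 - i) j
  | Vertical => Domino Vertical (2 * a - i) j
  end.

Lemma region_reflect_y (b : Z) (d : domino) (x y : R) :
  region (reflect_y b d) (x, y) <-> region d (x, (2 * IZR b + 1 - y)%R).
Proof.
destruct d as [[|] i j]; unfold reflect_y, region, unit_square; cbn [fst snd];
  rewrite ?plus_IZR, ?minus_IZR, ?mult_IZR;
  split; (intros [H|H]; [left + right | left + right]; lra).
Qed.

Lemma region_reflect_x (a : Z) (d : domino) (x y : R) :
  region (reflect_x a d) (x, y) <-> region d ((2 * IZR a + 1 - x)%R, y).
Proof.
destruct d as [[|] i j]; unfold reflect_x, region, unit_square; cbn [fst snd];
  rewrite ?plus_IZR, ?minus_IZR, ?mult_IZR;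
  split; (intros [H|H]; [left + right | left + right]; lra).
Qed.

(* Tilings of the cardinal rugged quadrants with tip [a, a+1] x [b, b+1]. *)
Definition north_quadrant (a b : Z) (d : domino) : Prop :=
  exists i k : Z, 0 <= k /\ d = Domino Vertical (a + i) (b + Z.abs i + 2 * k).

Definition south_quadrant (a b : Z) (d : domino) : Prop :=
  exists e : domino, north_quadrant a b e /\ d = reflect_y b e.

Definition east_quadrant (a b : Z) (d : domino) : Prop :=
  exists j k : Z, 0 <= k /\ d = Domino Horizontal (a + Z.abs j + 2 * k) (b + j).

Definition west_quadrant (a b : Z) (d : domino) : Prop :=
  exists e : domino, east_quadrant a b e /\ d = reflect_x a e.

(* The unit squares around the lattice point (x, y) have lower-left corners
   (x-1, y) (upper left), (x, y) (upper right), (x, y-1) (lower right) and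
   (x-1, y-1) (lower left). *)
Definition is_windmill (t : domino -> Prop) : Prop :=
  is_tiling t /\
  exists x y : Z,
    (forall d, t d <->
       north_quadrant (x - 1) y d \/ east_quadrant x y d \/
       south_quadrant x (y - 1) d \/ west_quadrant (x - 1) (y - 1) d)
    \/
    (forall d, t d <->
       north_quadrant x y d \/ east_quadrant x (y - 1) d \/
       south_quadrant (x - 1) (y - 1) d \/ west_quadrant (x - 1) y d).

(* Main.v *)
(* In a tiling without flips, every vertical domino has a staircase neighbour on
   each long side, and two stacked vertical dominoes have a common one on each
   side.  If a vertical domino has no lower left neighbour, then
   its upper left neighbour exists and has no lower left neighbour either, so an
   infinite ray goes up to the left.  Following the lower right neighbours, one
   gets either a full staircase, or a domino without lower neighbours on either
   side; the latter is the tip of a north quadrant contained in the tiling.  The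
   horizontal domino just below the tip is itself the tip of a quadrant, and
   turning around the common corner gives the four quadrants of a windmill.
   A full staircase, on the other hand, forces the two diagonals next to it to be
   filled by a staircase of the same direction: on such a pair of diagonals, a
   change of orientation would leave a cell that cannot be covered without a
   flip. *)
Require Import Defs.
From Stdlib Require Import Reals ZArith Lra Lia Classical.
From Coquelicot Require Import Coquelicot.
Open Scope Z_scope.

(** * Flip-free tilings as relations on lattice cells *)

Definition relZ := Z -> Z -> Prop.

(** [H i j] and [V i j] mean that the domino with lower-left cell [(i, j)] is present. Separate
    variables with side conditions let [lia] match positions. *)
Record flip_free (H V : relZ) : Prop := {
  cover : forall i j, H i j \/ H (i - 1) j \/ V i j \/ V i (j - 1);
  disjHH : forall i j k l, H i j -> H k l -> k = i + 1 -> l = j -> False;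
  disjVV : forall i j k l, V i j -> V k l -> k = i -> l = j + 1 -> False;
  disjHV : forall i j k l, H i j -> V k l ->
    i <= k <= i + 1 -> l <= j <= l + 1 -> False;
  noflipH : forall i j k l, H i j -> H k l -> k = i -> l = j + 1 -> False;
  noflipV : forall i j k l, V i j -> V k l -> k = i + 1 -> l = j -> False }.

Lemma rel_eq (A : relZ) (i j k l : Z) : A i j -> k = i -> l = j -> A k l.
Proof. intros h -> ->; exact h. Qed.

Ltac hit :=
  match goal with h : ?A _ _ |- ?A _ _ => apply (rel_eq A _ _ _ _ h); lia end.

Ltac clash :=
  exfalso;
  match goal with
  | F : flip_free ?H ?V, h : ?H _ _, h' : ?V _ _ |- _ =>
      apply (disjHV H V F _ _ _ _ h h'); lia
  | F : flip_free ?H ?V, h : ?H _ _, h' : ?H _ _ |- _ =>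
      apply (disjHH H V F _ _ _ _ h h'); lia
  | F : flip_free ?H ?V, h : ?V _ _, h' : ?V _ _ |- _ =>
      apply (disjVV H V F _ _ _ _ h h'); lia
  | F : flip_free ?H ?V, h : ?H _ _, h' : ?H _ _ |- _ =>
      apply (noflipH H V F _ _ _ _ h h'); lia
  | F : flip_free ?H ?V, h : ?V _ _, h' : ?V _ _ |- _ =>
      apply (noflipV H V F _ _ _ _ h h'); lia
  | h : ~ ?A _ _, h' : ?A _ _ |- _ =>
      apply h; apply (rel_eq A _ _ _ _ h'); lia
  end.

(** Only the covering cases that neither give the goal nor contradict the hypotheses at once are
    left open. *)
Ltac cell F i j :=
  let h := fresh "c" in
  destruct (cover _ _ F i j) as [h|[h|[h|h]]]; try (first [hit | clash]).

(** * Symmetries *)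

(** The cell [(i, j)] goes to [(- i, j)]; the right cell of a horizontal domino becomes its left
    one, hence the shift. *)
Definition mirrorH (H : relZ) : relZ := fun i j => H (- 1 - i) j.
Definition mirrorV (V : relZ) : relZ := fun i j => V (- i) j.

(* The quarter turn sends the cell (i, j) to (j, -i), so that what opens to the
   west opens to the north after the turn. *)
Definition rotH (V : relZ) : relZ := fun i j => V (- j) i.
Definition rotV (H : relZ) : relZ := fun i j => H (- 1 - j) i.

Lemma flip_free_mirror (H V : relZ) :
  flip_free H V -> flip_free (mirrorH H) (mirrorV V).
Proof.
intros F; unfold mirrorH, mirrorV; split; intros; try clash.
destruct (cover _ _ F (- i) j) as [h|[h|[h|h]]].
- right; left; hit.
- left; hit.
- right; right; left; hit.
- right; right; right; hit.
Qed.

Lemma flip_free_rot (H V : relZ) :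
  flip_free H V -> flip_free (rotH V) (rotV H).
Proof.
intros F; unfold rotH, rotV; split; intros; try clash.
destruct (cover _ _ F (- j) i) as [h|[h|[h|h]]].
- right; right; right; hit.
- right; right; left; hit.
- left; hit.
- right; left; hit.
Qed.

(** Being a union of staircases of step [(1, s)] amounts to this translation invariance. *)
Definition invariant (s : Z) (H V : relZ) : Prop :=
  forall i j, (H i j <-> H (i + 1) (j + s)) /\ (V i j <-> V (i + 1) (j + s)).

(* (a, b) is the tip of the north quadrant, which sits upper left. *)
Definition pinwheel (H V : relZ) (a b : Z) : Prop :=
  forall i k, 0 <= k ->
    V (a + i) (b + Z.abs i + 2 * k) /\
    H (a - 1 - Z.abs i - 2 * k) (b - 1 + i) /\
    V (a + 1 + i) (b - 2 - Z.abs i - 2 * k) /\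
    H (a + 1 + Z.abs i + 2 * k) (b + i).

(** The second windmill arrangement is the mirror image of the first. *)
Definition classified (H V : relZ) : Prop :=
  (exists s, (s = 1 \/ s = -1) /\ invariant s H V) \/
  (exists a b, pinwheel H V a b) \/
  (exists a b, pinwheel (mirrorH H) (mirrorV V) a b).

Lemma classified_mirror (H V : relZ) :
  classified (mirrorH H) (mirrorV V) -> classified H V.
Proof.
unfold mirrorH, mirrorV.
intros [(s & hs & I)|[(a & b & P)|(a & b & P)]].
- left; exists (- s); split; [lia|]; intros i j.
  destruct (I (- 2 - i) (j - s)) as [[I1 I2] _].
  destruct (I (- 1 - i) (j - s)) as [_ [I3 I4]].
  split; split; intros h.
  + assert (h' : H (-1 - (-2 - i)) (j - s)) by (apply I2; hit). hit.
  + assert (h' : H (-1 - (-2 - i + 1)) (j - s + s)) by (apply I1; hit). hit.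
  + assert (h' : V (- (-1 - i)) (j - s)) by (apply I4; hit). hit.
  + assert (h' : V (- (-1 - i + 1)) (j - s + s)) by (apply I3; hit). hit.
- right; right; exists a, b; exact P.
- right; left; exists a, b; intros i k hk.
  destruct (P i k hk) as (h1 & h2 & h3 & h4).
  unfold mirrorH, mirrorV in *.
  repeat split; hit.
Qed.

Lemma classified_rot (H V : relZ) :
  classified (rotH V) (rotV H) -> classified H V.
Proof.
intros [(s & hs & I)|[(a & b & P)|(a & b & P)]].
- left; exists (- s); split; [lia|]; intros i j.
  (* Turned back, the step [(1, s)] becomes [(- s, 1)], which is [(1, - s)] up to sign. *)
  assert (I' : forall x y, (V x y <-> V (x - s) (y + 1)) /\
                           (H x y <-> H (x - s) (y + 1))).
  { intros x y.
    destruct (I y (- x)) as [I1 _], (I y (- 1 - x)) as [_ I2].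
    unfold rotH, rotV in I1, I2.
    replace (- - x) with x in I1 by lia.
    replace (- (- x + s)) with (x - s) in I1 by lia.
    replace (-1 - (-1 - x)) with x in I2 by lia.
    replace (-1 - (-1 - x + s)) with (x - s) in I2 by lia.
    tauto. }
  destruct hs as [-> | ->].
  + destruct (I' (i + 1) (j + -1)) as [A B].
    replace (i + 1 - 1) with i in A, B by lia.
    replace (j + -1 + 1) with j in A, B by lia. tauto.
  + destruct (I' i j) as [A B].
    replace (i - -1) with (i + 1) in A, B by lia. tauto.
- right; left; exists (- b), (a + 1); intros i k hk.
  destruct (P i k hk) as (h1 & h2 & h3 & h4).
  destruct (P (- i) k hk) as (h5 & h6 & h7 & h8).
  unfold rotH, rotV in *.
  repeat split; hit.
- right; right; exists (b - 1), (- a); intros i k hk.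
  destruct (P i k hk) as (h1 & h2 & h3 & h4).
  destruct (P (- i) k hk) as (h5 & h6 & h7 & h8).
  unfold mirrorH, mirrorV, rotH, rotV in *.
  repeat split; hit.
Qed.

(** * Full staircases *)

(* The diagonals j - i = c and j - i = c + 1 are filled by a staircase. *)
Definition full_staircase (H V : relZ) (c : Z) : Prop :=
  (forall i, V i (i + c)) \/ (forall i, H (i - 1) (i + c)).

Lemma Z_spread (Q : Z -> Prop) (m : Z) :
  (forall i, Q i -> Q (i + 1)) -> (forall i, Q i -> Q (i - 1)) -> Q m ->
  forall i, Q i.
Proof.
intros up down h i.
replace i with (m + (i - m)) by lia.
generalize (i - m); apply Z.bi_induction.
- intros x y ->; tauto.
- now rewrite Z.add_0_r.
- intros n; split; intros q.
  + apply up in q. now replace (m + Z.succ n) with (m + n + 1) by lia.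
  + apply down in q. now replace (m + n) with (m + Z.succ n - 1) by lia.
Qed.

(** The diagonal [c + 1] being occupied, each cell of the diagonal [c + 2] pairs with its upper or
    left neighbour on the diagonal [c + 3]; adjacent cells must choose alike. *)
Lemma full_staircase_next (H V : relZ) (c : Z) :
  flip_free H V -> full_staircase H V c -> full_staircase H V (c + 2).
Proof.
intros F P.
assert (nV : forall i j, j = i + c + 1 -> ~ V i j).
{ intros i j -> h; destruct P as [P|P]; specialize (P i) as P0;
  specialize (P (i + 1)); clash. }
assert (nH : forall i j, j = i + c + 2 -> ~ H i j).
{ intros i j -> h; destruct P as [P|P]; specialize (P (i + 1)) as P0;
  specialize (P (i + 2)); clash. }
assert (alt : forall i, V i (i + (c + 2)) \/ H (i - 1) (i + (c + 2))).
{ intros i.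
  pose proof (nV i (i + (c + 1)) ltac:(lia)).
  pose proof (nH i (i + (c + 2)) ltac:(lia)).
  cell F i (i + (c + 2)); [right|left]; hit. }
assert (HL : forall i, H (i - 1) (i + (c + 2)) ->
                       H (i - 1 - 1) (i - 1 + (c + 2))).
{ intros i h; destruct (alt (i - 1)); [clash|assumption]. }
(* A horizontal step at i and a vertical one at i + 1 leave the cell
   (i, i + c + 3) no partner without a flip. *)
assert (HR : forall i, H (i - 1) (i + (c + 2)) ->
                       H (i + 1 - 1) (i + 1 + (c + 2))).
{ intros i h; destruct (alt (i + 1)) as [v|]; [|assumption].
  cell F i (i + (c + 3)). }
destruct (alt 0) as [v|h].
- left; apply (Z_spread _ 0); [| |hit]; intros i v'.
  + destruct (alt (i + 1)) as [|h]; [assumption|].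
    apply HL in h; clash.
  + destruct (alt (i - 1)) as [|h]; [assumption|].
    apply HR in h; clash.
- right; apply (Z_spread _ 0); [| |hit]; assumption.
Qed.

(** The half turn negates [j - i], so that [full_staircase_next] also serves to go down from [c] to
    [c - 2]. *)
Lemma full_staircase_rot2 (H V : relZ) (c : Z) :
  full_staircase H V c <->
  full_staircase (rotH (rotV H)) (rotV (rotH V)) (- 1 - c).
Proof.
unfold full_staircase, rotH, rotV.
split; (intros [P|P]; [left|right]); intros i; specialize (P (- i)) as P0;
  specialize (P (1 - i)); hit.
Qed.

Lemma full_staircase_invariant (H V : relZ) (c : Z) :
  flip_free H V -> full_staircase H V c -> invariant 1 H V.
Proof.
intros F P.
assert (all : forall n, full_staircase H V (c + 2 * n)).
{ apply (Z_spread _ 0); [| |now rewrite Z.add_0_r]; intros n Pn.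
  - apply full_staircase_next in Pn; [|assumption].
    now replace (c + 2 * (n + 1)) with (c + 2 * n + 2) by lia.
  - apply full_staircase_rot2 in Pn.
    apply full_staircase_next in Pn;
      [|now apply flip_free_rot, flip_free_rot].
    apply full_staircase_rot2.
    now replace (-1 - (c + 2 * (n - 1))) with (-1 - (c + 2 * n) + 2) by lia. }
intros i j.
assert (E : exists n, j - i = c + 2 * n \/ j - i = c + 2 * n + 1).
{ exists ((j - i - c) / 2).
  pose proof (Z.div_mod (j - i - c) 2); pose proof (Z.mod_pos_bound (j - i - c) 2).
  lia. }
destruct E as [n E].
(* A domino belongs to the staircase through its lower-left cell or overlaps a member of it. *)
split; split; intros h; destruct E as [E|E];
  destruct (all n) as [Q|Q];
  pose proof (Q i); pose proof (Q (i + 1)); pose proof (Q (i + 2));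
  first [hit | clash].
Qed.

(** * Tips and pinwheels *)

(** Otherwise both cells on the left are right ends of horizontal dominoes, which form a flip. *)
Lemma left_neighbour (H V : relZ) (i j : Z) :
  flip_free H V -> V i j -> V (i - 1) (j - 1) \/ V (i - 1) (j + 1).
Proof.
intros F h.
destruct (classic (V (i - 1) (j - 1))); [now left|].
destruct (classic (V (i - 1) (j + 1))); [now right|].
cell F (i - 1) j; cell F (i - 1) (j + 1).
Qed.

(** A vertical domino level with either of the two makes a flip, and so do two horizontal ones
    ending beside the junction. *)
Lemma left_of_stacked (H V : relZ) (i j : Z) :
  flip_free H V -> V i j -> V i (j + 2) -> V (i - 1) (j + 1).
Proof.
intros F h h'.
destruct (classic (V (i - 1) (j + 1))); [assumption|].
cell F (i - 1) (j + 1); cell F (i - 1) (j + 2).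
Qed.

Lemma above_bend (H V : relZ) (i j : Z) :
  flip_free H V -> V i j -> V (i - 1) (j + 1) -> V (i + 1) (j + 1) ->
  V i (j + 2).
Proof. intros F h hl hr; cell F i (j + 2). Qed.

(** With [V (i - 1 - 1) j] present, the cell [(i - 1, j)] could only be covered by the excluded
    [V (i - 1) (j - 1)]. *)
Lemma lacks_lower_left_step (H V : relZ) (i j : Z) :
  flip_free H V -> V i j -> ~ V (i - 1) (j - 1) ->
  V (i - 1) (j + 1) /\ ~ V (i - 1 - 1) (j + 1 - 1).
Proof.
intros F h n.
assert (h' : V (i - 1) (j + 1)) by (destruct (left_neighbour H V i j F h); tauto).
split; [assumption|]; intros h2.
cell F (i - 1) j.
Qed.

Definition north_tip (V : relZ) (a b : Z) : Prop :=
  V a b /\ ~ V (a - 1) (b - 1) /\ ~ V (a + 1) (b - 1).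

Lemma upper_left_ray (H V : relZ) (a b m : Z) :
  flip_free H V -> V a b -> ~ V (a - 1) (b - 1) -> 0 <= m ->
  V (a - m) (b + m).
Proof.
intros F h n hm.
enough (V (a - m) (b + m) /\ ~ V (a - m - 1) (b + m - 1)) by tauto.
revert m hm; apply natlike_ind.
- now rewrite Z.sub_0_r, Z.add_0_r.
- intros m hm [h' n'].
  destruct (lacks_lower_left_step H V _ _ F h' n') as [A B].
  replace (a - Z.succ m) with (a - m - 1) by lia.
  now replace (b + Z.succ m) with (b + m + 1) by lia.
Qed.

(** The two rays from the tip form layer [0]; each further layer fills the notches of the one
    below. *)
Lemma north_tip_cone (H V : relZ) (a b i k : Z) :
  flip_free H V -> north_tip V a b -> 0 <= k ->
  V (a + i) (b + Z.abs i + 2 * k).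
Proof.
intros F (h & nl & nr) hk.
revert k hk i; apply (natlike_ind (fun k => forall i, _)).
- intros i; destruct (Z.le_ge_cases i 0).
  + pose proof (upper_left_ray H V a b (- i) F h nl ltac:(lia)); hit.
  + assert (h' : mirrorV V (- a) b) by (unfold mirrorV; hit).
    assert (n' : ~ mirrorV V (- a - 1) (b - 1))
      by (unfold mirrorV; intros q; apply nr; hit).
    pose proof (upper_left_ray _ _ _ _ i (flip_free_mirror H V F) h' n'
                  ltac:(lia)) as q.
    unfold mirrorV in q; hit.
- intros k hk IH.
  (* The new layer grows outwards from column [a]: past that column, the inner neighbour is in the
     new layer and the outer one in the old. *)
  assert (pos : forall m, 0 <= m ->
    V (a + m) (b + m + 2 * Z.succ k) /\ V (a - m) (b + m + 2 * Z.succ k)).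
  { apply natlike_ind.
    - pose proof (IH 0); pose proof (IH 1); pose proof (IH (-1)).
      assert (V a (b + 2 * k + 2))
        by (apply (above_bend H V a (b + 2 * k) F); hit).
      split; hit.
    - intros m hm [P1 P2].
      pose proof (IH (m + 1)); pose proof (IH (m + 2)).
      pose proof (IH (- m - 1)); pose proof (IH (- m - 2)).
      assert (V (a + m + 1) (b + m + 1 + 2 * k + 2))
        by (apply (above_bend H V _ _ F); hit).
      assert (V (a - m - 1) (b + m + 1 + 2 * k + 2))
        by (apply (above_bend H V _ _ F); hit).
      split; hit. }
  intros i; destruct (pos (Z.abs i)) as [P1 P2]; [lia|].
  destruct (Z.le_ge_cases i 0); hit.
Qed.

(* In the original coordinates: H (a - 1) (b - 1) is the tip of a west quadrant
   in cell (a, b - 1), and V (a + 1) (b - 2) lies behind it, so that the lemma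
   applies again to the quarter turn. *)
Lemma next_tip (H V : relZ) (a b : Z) :
  flip_free H V -> north_tip V a b -> H (a - 1) (b - 1) ->
  north_tip (rotV H) (b - 1) (- a) /\ rotH V (b - 1 - 1) (- a - 1).
Proof.
intros F (h & nl & nr) hw.
assert (V (a + 1) (b - 2)).
(* To avoid a flip with the tip, the cell [(a + 1, b)] opens a horizontal domino, and the cell below
   it must then extend downwards. *)
{ cell F (a + 1) b; cell F (a + 1) (b - 1). }
unfold north_tip, rotV, rotH.
repeat split; try hit; intros q; clash.
Qed.

Lemma tip_pinwheel (H V : relZ) (a b : Z) :
  flip_free H V -> north_tip V a b -> H (a - 1) (b - 1) -> pinwheel H V a b.
Proof.
intros F0 t0 h0.
destruct (next_tip _ _ _ _ F0 t0 h0) as [t1 h1].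
pose proof (flip_free_rot _ _ F0) as F1.
destruct (next_tip _ _ _ _ F1 t1 h1) as [t2 h2].
pose proof (flip_free_rot _ _ F1) as F2.
destruct (next_tip _ _ _ _ F2 t2 h2) as [t3 h3].
pose proof (flip_free_rot _ _ F2) as F3.
intros i k hk.
pose proof (north_tip_cone _ _ _ _ i k F0 t0 hk) as c0.
pose proof (north_tip_cone _ _ _ _ i k F1 t1 hk) as c1.
(* The half and three-quarter turns reverse the index [i]. *)
pose proof (north_tip_cone _ _ _ _ (- i) k F2 t2 hk) as c2.
pose proof (north_tip_cone _ _ _ _ (- i) k F3 t3 hk) as c3.
clear h0 h1 h2 h3 t0 t1 t2 t3 F0 F1 F2 F3.
unfold rotH, rotV in *.
repeat split; hit.
Qed.

(** The cell below the tip lies in a horizontal domino; its extending left or right are mirror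
    cases. *)
Lemma tip_classified (H V : relZ) (a b : Z) :
  flip_free H V -> north_tip V a b -> classified H V.
Proof.
intros F T; pose proof T as (h & nl & nr).
destruct (classic (H (a - 1) (b - 1))) as [hw|nw].
- right; left; exists a, b; now apply tip_pinwheel.
- right; right; exists (- a), b.
  apply tip_pinwheel; [now apply flip_free_mirror| |].
  + repeat split; unfold mirrorV; [hit| |]; intros q; [apply nr|apply nl]; hit.
  + unfold mirrorH.
    destruct (classic (V a (b - 2))) as [v|nv].
    (* Stacked dominoes would have the lower left neighbour that the tip lacks. *)
    * assert (v' : V (a - 1) (b - 2 + 1))
        by (apply (left_of_stacked H V _ _ F v); hit).
      clash.
    * cell F a (b - 1).
Qed.

(** * Classification of flip-free tilings *)

Lemma lacks_lower_left_classified (H V : relZ) (c d : Z) :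
  flip_free H V -> V c d -> ~ V (c - 1) (d - 1) -> classified H V.
Proof.
intros F h n.
(* [Q] follows the lower right neighbours: an unending chain is a full staircase of step [(1, -1)],
   and a chain that stops ends at a tip. *)
set (Q m := V (c + m) (d - m) /\ ~ V (c + m - 1) (d - m - 1)).
destruct (classic (forall m, Q m -> Q (m + 1))) as [all|stop].
- assert (full : forall m, Q m).
  { apply (Z_spread _ 0); [exact all| |split; [hit|intros q; apply n; hit]].
    intros m [h' n']; destruct (lacks_lower_left_step H V _ _ F h' n') as [A B].
    split; [hit|]; intros q; apply B; hit. }
  apply classified_mirror; left; exists 1; split; [now left|].
  apply (full_staircase_invariant _ _ (c + d)); [now apply flip_free_mirror|].
  left; intros i; destruct (full (- i - c)) as [v _].
  unfold mirrorV; hit.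
- apply not_all_ex_not in stop as [m stop].
  apply imply_to_and in stop as [[h' n'] stop].
  apply (tip_classified H V (c + m) (d - m) F).
  repeat split; [assumption|assumption|]; intros v; apply stop.
  split; [hit|]; intros v'.
  (* [v'] would be stacked below the current domino, forcing the left neighbour that [n']
     excludes. *)
  assert (V (c + m - 1) (d - m - 2 + 1))
    by (apply (left_of_stacked H V _ _ F); hit).
  clash.
Qed.

(** A missing upper right neighbour becomes a missing lower left one after a half turn; if none is
    missing, the staircase through [(i, j)] is full. *)
Lemma vertical_classified (H V : relZ) (i j : Z) :
  flip_free H V -> V i j -> classified H V.
Proof.
intros F h.
destruct (classic (exists k l, V k l /\ ~ V (k - 1) (l - 1)))
  as [(k & l & v & n)|noL].
{ exact (lacks_lower_left_classified H V k l F v n). }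
destruct (classic (exists k l, V k l /\ ~ V (k + 1) (l + 1)))
  as [(k & l & v & n)|noR].
{ apply classified_rot, classified_rot.
  apply (lacks_lower_left_classified _ _ (- k) (- 1 - l)).
  - now apply flip_free_rot, flip_free_rot.
  - unfold rotH, rotV; hit.
  - unfold rotH, rotV; intros q; apply n; hit. }
left; exists 1; split; [now left|].
apply (full_staircase_invariant H V (j - i) F); left.
apply (Z_spread _ i); [| |hit]; intros k v; apply NNPP; intros n.
- apply noR; exists k, (k + (j - i)); split; [assumption|]; intros q; apply n; hit.
- apply noL; exists k, (k + (j - i)); split; [assumption|]; intros q; apply n; hit.
Qed.

Lemma flip_free_classified (H V : relZ) : flip_free H V -> classified H V.
Proof.
intros F.
assert (hor : forall i j, H i j -> classified H V).
{ intros i j h; apply classified_rot.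
  apply (vertical_classified _ _ j (- 1 - i)); [now apply flip_free_rot|].
  unfold rotV; hit. }
destruct (cover _ _ F 0 0) as [h|[h|[h|h]]];
  eauto using vertical_classified.
Qed.

(** * From plane regions to lattice cells *)

Definition covers (d : domino) (i j : Z) : Prop :=
  match dir d with
  | Horizontal => left d <= i <= left d + 1 /\ j = bottom d
  | Vertical => i = left d /\ bottom d <= j <= bottom d + 1
  end.

(** Centres lie off the grid lines, so closed regions can be compared cell by cell in integers. *)
Definition center (i j : Z) : plane := ((IZR i + / 2)%R, (IZR j + / 2)%R).

Lemma half_between (a b i : Z) :
  (IZR a <= IZR i + / 2 <= IZR b)%R <-> a <= i < b.
Proof.
split.
- intros [h1 h2].
  assert (a < i + 1) by (apply lt_IZR; rewrite plus_IZR; lra).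
  assert (i < b) by (apply lt_IZR; lra).
  lia.
- intros [h1 h2].
  assert (h2' : i + 1 <= b) by lia.
  apply IZR_le in h1, h2'; rewrite plus_IZR in h2'; lra.
Qed.

Lemma region_center (d : domino) (i j : Z) :
  region d (center i j) <-> covers d i j.
Proof.
destruct d as [[|] x y]; unfold region, unit_square, covers, center;
  cbn [fst snd dir left bottom]; rewrite !half_between; lia.
Qed.

Lemma interior_center (d : domino) (i j : Z) :
  covers d i j -> plane_interior (region d) (center i j).
Proof.
intros c; exists (mkposreal (/ 4)%R ltac:(lra)); intros [x y] [bx by_].
cbv -[Rlt Rabs Rminus Rplus Ropp IZR Rinv Rmult Rdiv] in bx, by_.
apply Rabs_def2 in bx, by_.
destruct d as [[|] k l]; unfold covers in c; cbn [dir left bottom] in c;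
  unfold region, unit_square; cbn [fst snd].
- assert (E : i = k \/ i = k + 1) by lia; destruct c as [_ ->].
  destruct E as [-> | ->]; [left|right]; rewrite ?plus_IZR in *; lra.
- assert (E : j = l \/ j = l + 1) by lia; destruct c as [-> _].
  destruct E as [-> | ->]; [left|right]; rewrite ?plus_IZR in *; lra.
Qed.

Lemma tiling_covers (t : domino -> Prop) (i j : Z) :
  is_tiling t -> exists d, t d /\ covers d i j.
Proof.
intros [_ cov]; destruct (cov (center i j)) as (d & td & r).
exists d; split; [assumption|now apply region_center].
Qed.

Lemma tiling_unique (t : domino -> Prop) (d e : domino) (i j : Z) :
  is_tiling t -> t d -> t e -> covers d i j -> covers e i j -> d = e.
Proof.
intros [dis _] td te cd ce; apply NNPP; intros n.
apply (dis d e td te n).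
exists (center i j); split; now apply interior_center.
Qed.

Lemma admits_flip_iff (t : domino -> Prop) :
  admits_flip t <-> exists i j,
    (t (Domino Horizontal i j) /\ t (Domino Horizontal i (j + 1))) \/
    (t (Domino Vertical i j) /\ t (Domino Vertical (i + 1) j)).
Proof.
split.
- intros (d & e & td & te & E & a & b & R).
  assert (C : forall i j, covers d i j \/ covers e i j <->
                          a <= i < a + 2 /\ b <= j < b + 2).
  { intros i j; rewrite <- !region_center, R; unfold center; cbn [fst snd].
    now rewrite !half_between. }
  clear R; exists a, b.
  destruct d as [o x y], e as [o' x' y']; cbn in E; subst o'.
  (* Testing the cells of both dominoes and the four cells of the square determines the positions by
     linear arithmetic. *)
  pose proof (C x y) as C1; pose proof (C x' y') as C2.
  pose proof (C (x + 1) y) as C3; pose proof (C (x' + 1) y') as C4.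
  pose proof (C x (y + 1)) as C5; pose proof (C x' (y' + 1)) as C6.
  pose proof (C a b) as C7; pose proof (C (a + 1) b) as C8.
  pose proof (C a (b + 1)) as C9; pose proof (C (a + 1) (b + 1)) as C10.
  clear C; destruct o; unfold covers in *; cbn [dir left bottom] in *.
  + left; clear C5 C6.
    assert (X : x = a /\ x' = a) by lia; destruct X as [-> ->].
    assert (Y : (y = b /\ y' = b + 1) \/ (y = b + 1 /\ y' = b)) by lia.
    destruct Y as [[-> ->]|[-> ->]]; auto.
  + right; clear C3 C4.
    assert (Y : y = b /\ y' = b) by lia; destruct Y as [-> ->].
    assert (X : (x = a /\ x' = a + 1) \/ (x = a + 1 /\ x' = a)) by lia.
    destruct X as [[-> ->]|[-> ->]]; auto.
- intros (i & j & [[h h']|[h h']]);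
    [exists (Domino Horizontal i j), (Domino Horizontal i (j + 1))
    |exists (Domino Vertical i j), (Domino Vertical (i + 1) j)];
    (split; [assumption|]; split; [assumption|]; split; [reflexivity|]);
    exists i, j; intros [x y]; unfold region, unit_square; cbn [fst snd];
    rewrite ?plus_IZR;
    (split; [intros [[]|[]]; lra|]); intros [hx hy];
    destruct (Rle_dec x (IZR i + 1)), (Rle_dec y (IZR j + 1));
    first [ left; left; lra | left; right; lra
          | right; left; lra | right; right; lra ].
Qed.

Definition hor (t : domino -> Prop) : relZ := fun i j => t (Domino Horizontal i j).
Definition ver (t : domino -> Prop) : relZ := fun i j => t (Domino Vertical i j).

Lemma tiling_flip_free (t : domino -> Prop) :
  is_tiling t -> ~ admits_flip t -> flip_free (hor t) (ver t).
Proof.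
intros T N; unfold hor, ver.
split; intros i j.
- destruct (tiling_covers t i j T) as ([[|] x y] & td & c);
    unfold covers in c; cbn [dir left bottom] in c.
  + assert (E : x = i \/ x = i - 1) by lia; destruct c as [_ ->].
    destruct E as [-> | ->]; auto.
  + assert (E : y = j \/ y = j - 1) by lia; destruct c as [-> _].
    destruct E as [-> | ->]; auto.
- intros k l h h' -> ->.
  assert (E := tiling_unique t _ _ (i + 1) j T h h'); unfold covers in E.
  cbn [dir left bottom] in E.
  specialize (E ltac:(lia) ltac:(lia)); injection E; lia.
- intros k l h h' -> ->.
  assert (E := tiling_unique t _ _ i (j + 1) T h h'); unfold covers in E.
  cbn [dir left bottom] in E.
  specialize (E ltac:(lia) ltac:(lia)); injection E; lia.
- intros k l h h' hk hl.
  assert (E := tiling_unique t _ _ k j T h h'); unfold covers in E.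
  cbn [dir left bottom] in E.
  specialize (E ltac:(lia) ltac:(lia)); discriminate E.
- intros k l h h' -> ->; apply N, admits_flip_iff; exists i, j; auto.
- intros k l h h' -> ->; apply N, admits_flip_iff; exists i, j; auto.
Qed.

(** * From relations back to staircases and windmills *)

Lemma invariant_staircases (t : domino -> Prop) (s : Z) :
  s = 1 \/ s = -1 -> invariant s (hor t) (ver t) ->
  consists_of_parallel_staircases t.
Proof.
intros hs I.
assert (T : forall d k, t d -> t (translate d (k * 1, k * s))).
{ intros [o x y] k h; revert k; apply (Z_spread _ 0).
  - intros k; unfold translate; cbn [dir left bottom fst snd].
    destruct (I (x + k * 1) (y + k * s)) as [[IH _] [IV _]].
    replace (x + (k + 1) * 1) with (x + k * 1 + 1) by lia.
    replace (y + (k + 1) * s) with (y + k * s + s) by lia.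
    destruct o; assumption.
  - intros k; unfold translate; cbn [dir left bottom fst snd].
    destruct (I (x + (k - 1) * 1) (y + (k - 1) * s)) as [[_ IH] [_ IV]].
    replace (x + k * 1) with (x + (k - 1) * 1 + 1) by lia.
    replace (y + k * s) with (y + (k - 1) * s + s) by lia.
    destruct o; assumption.
  - unfold translate; cbn [dir left bottom fst snd].
    now rewrite !Z.mul_0_l, !Z.add_0_r. }
assert (TT : forall d k l,
  translate (translate d (k * 1, k * s)) (l * 1, l * s) =
  translate d ((k + l) * 1, (k + l) * s)).
{ intros [o x y] k l; unfold translate; cbn [dir left bottom fst snd].
  f_equal; lia. }
assert (T0 : forall d, translate d (0 * 1, 0 * s) = d).
{ intros [o x y]; unfold translate; cbn [dir left bottom fst snd].
  f_equal; lia. }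
exists (1, s); split; [destruct hs as [-> | ->]; auto|].
set (orbit D := fun d => exists k, d = translate D (k * 1, k * s)).
(* The orbits under the step, taken up to pointwise equivalence. *)
exists (fun A => exists D, t D /\ forall d, A d <-> orbit D d).
split; [|split].
- intros A (D & tD & AD); exists D; exact AD.
- intros A B (D & tD & AD) (E & tE & BE) (d & Ad & Bd) e.
  apply AD in Ad as [k ->]; apply BE in Bd as [l q].
  rewrite AD, BE; split; intros [m ->].
  + exists (l + (m - k)); rewrite <- TT, <- q, TT; do 3 f_equal; lia.
  + exists (k + (m - l)); rewrite <- TT, q, TT; do 3 f_equal; lia.
- intros d; split.
  + intros td; exists (orbit d); split; [exists d; tauto|].
    exists 0; now rewrite T0.
  + intros (A & (D & tD & AD) & Ad).
    apply AD in Ad as [k ->]; now apply T.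
Qed.

(** Reflection swaps the two cells of a vertical domino, whence [b - 1]. *)
Lemma south_quadrant_iff (a b : Z) (d : domino) :
  south_quadrant a b d <-> exists i k, 0 <= k /\
    d = Domino Vertical (a + i) (b - 1 - Z.abs i - 2 * k).
Proof.
split.
- intros (e & (i & k & hk & ->) & ->); exists i, k; split; [assumption|].
  unfold reflect_y; f_equal; lia.
- intros (i & k & hk & ->); exists (Domino Vertical (a + i) (b + Z.abs i + 2 * k)).
  split; [now exists i, k|]; unfold reflect_y; f_equal; lia.
Qed.

Lemma west_quadrant_iff (a b : Z) (d : domino) :
  west_quadrant a b d <-> exists j k, 0 <= k /\
    d = Domino Horizontal (a - 1 - Z.abs j - 2 * k) (b + j).
Proof.
split.
- intros (e & (i & k & hk & ->) & ->); exists i, k; split; [assumption|].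
  unfold reflect_x; f_equal; lia.
- intros (j & k & hk & ->); exists (Domino Horizontal (a + Z.abs j + 2 * k) (b + j)).
  split; [now exists j, k|]; unfold reflect_x; f_equal; lia.
Qed.

(** Dominoes of the tiling that already cover every cell leave no room for another one. *)
Lemma tiling_eq (t Q : domino -> Prop) :
  is_tiling t -> (forall d, Q d -> t d) ->
  (forall i j, exists d, Q d /\ covers d i j) -> forall d, t d <-> Q d.
Proof.
intros T sub cov d; split; [|apply sub]; intros td.
destruct (cov (left d) (bottom d)) as (e & Qe & c).
rewrite (tiling_unique t d e (left d) (bottom d)); auto.
destruct d as [[|] x y]; unfold covers; cbn [dir left bottom]; lia.
Qed.

Lemma half_nonneg (r : Z) :
  0 <= r -> exists k, 0 <= k /\ (r = 2 * k \/ r = 2 * k + 1).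
Proof.
intros hr; exists (r / 2).
pose proof (Z.div_mod r 2); pose proof (Z.mod_pos_bound r 2); lia.
Qed.

Lemma north_covers (a b i j : Z) :
  Z.abs (i - a) <= j - b -> exists d, north_quadrant a b d /\ covers d i j.
Proof.
intros h; destruct (half_nonneg (j - b - Z.abs (i - a))) as (k & hk & E); [lia|].
eexists; split; [exists (i - a), k; split; [assumption|reflexivity]|].
unfold covers; cbn [dir left bottom]; lia.
Qed.

Lemma east_covers (a b i j : Z) :
  Z.abs (j - b) <= i - a -> exists d, east_quadrant a b d /\ covers d i j.
Proof.
intros h; destruct (half_nonneg (i - a - Z.abs (j - b))) as (k & hk & E); [lia|].
eexists; split; [exists (j - b), k; split; [assumption|reflexivity]|].
unfold covers; cbn [dir left bottom]; lia.
Qed.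

Lemma south_covers (a b i j : Z) :
  Z.abs (i - a) <= b - j -> exists d, south_quadrant a b d /\ covers d i j.
Proof.
intros h; destruct (half_nonneg (b - j - Z.abs (i - a))) as (k & hk & E); [lia|].
eexists; rewrite south_quadrant_iff.
split; [exists (i - a), k; split; [assumption|reflexivity]|].
unfold covers; cbn [dir left bottom]; lia.
Qed.

Lemma west_covers (a b i j : Z) :
  Z.abs (j - b) <= a - i -> exists d, west_quadrant a b d /\ covers d i j.
Proof.
intros h; destruct (half_nonneg (a - i - Z.abs (j - b))) as (k & hk & E); [lia|].
eexists; rewrite west_quadrant_iff.
split; [exists (j - b), k; split; [assumption|reflexivity]|].
unfold covers; cbn [dir left bottom]; lia.
Qed.

Lemma pinwheel_windmill (t : domino -> Prop) (a b : Z) :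
  is_tiling t -> pinwheel (hor t) (ver t) a b -> is_windmill t.
Proof.
(* The cell [(a, b)] is the upper left square at the point [(a + 1, b)]. *)
intros T P; split; [assumption|]; exists (a + 1), b; left.
apply tiling_eq; [assumption| |].
- intros d; rewrite south_quadrant_iff, west_quadrant_iff.
  intros [(i & k & hk & ->)|[(i & k & hk & ->)|[(i & k & hk & ->)|(i & k & hk & ->)]]];
    destruct (P i k hk) as (h1 & h2 & h3 & h4); unfold hor, ver in *.
  + now replace (a + 1 - 1 + i) with (a + i) by lia.
  + assumption.
  + now replace (b - 1 - 1) with (b - 2) by lia.
  + now replace (a + 1 - 1 - 1) with (a - 1) by lia.
- intros i j.
  assert (C : Z.abs (i - (a + 1 - 1)) <= j - b \/
              Z.abs (j - b) <= i - (a + 1) \/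
              Z.abs (i - (a + 1)) <= b - 1 - j \/
              Z.abs (j - (b - 1)) <= a + 1 - 1 - i) by lia.
  destruct C as [C|[C|[C|C]]];
    [apply north_covers in C|apply east_covers in C
    |apply south_covers in C|apply west_covers in C];
    destruct C as (d & q & c); exists d; tauto.
Qed.

Lemma mirror_pinwheel_windmill (t : domino -> Prop) (a b : Z) :
  is_tiling t -> pinwheel (mirrorH (hor t)) (mirrorV (ver t)) a b ->
  is_windmill t.
Proof.
(* The reflected tip [(- a, b)] is the upper right square at the point [(- a, b)]. *)
intros T P; split; [assumption|]; exists (- a), b; right.
apply tiling_eq; [assumption| |].
- intros d; rewrite south_quadrant_iff, west_quadrant_iff.
  intros [(i & k & hk & ->)|[(i & k & hk & ->)|[(i & k & hk & ->)|(i & k & hk & ->)]]];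
    destruct (P i k hk) as (h1 & h2 & h3 & h4);
    destruct (P (- i) k hk) as (h5 & h6 & h7 & h8);
    unfold hor, ver, mirrorH, mirrorV in *.
  + replace (- a + i) with (- (a + - i)) by lia.
    now rewrite <- (Z.abs_opp i).
  + now replace (- a + Z.abs i + 2 * k)
      with (-1 - (a - 1 - Z.abs i - 2 * k)) by lia.
  + replace (- a - 1 + i) with (- (a + 1 + - i)) by lia.
    replace (b - 1 - 1) with (b - 2) by lia.
    now rewrite <- (Z.abs_opp i).
  + now replace (- a - 1 - 1 - Z.abs i - 2 * k)
      with (-1 - (a + 1 + Z.abs i + 2 * k)) by lia.
- intros i j.
  assert (C : Z.abs (i - - a) <= j - b \/
              Z.abs (j - (b - 1)) <= i - - a \/
              Z.abs (i - (- a - 1)) <= b - 1 - j \/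
              Z.abs (j - b) <= - a - 1 - i) by lia.
  destruct C as [C|[C|[C|C]]];
    [apply north_covers in C|apply east_covers in C
    |apply south_covers in C|apply west_covers in C];
    destruct C as (d & q & c); exists d; tauto.
Qed.

(** * Exclusiveness *)

Lemma staircases_translate (t : domino -> Prop) :
  consists_of_parallel_staircases t ->
  exists s, (s = 1 \/ s = -1) /\
    forall o i j, t (Domino o i j) ->
      t (Domino o (i + 1) (j + s)) /\ t (Domino o (i - 1) (j - s)).
Proof.
intros ([u s] & hs & F & st & _ & tF).
assert (u = 1 /\ (s = 1 \/ s = -1)) as [-> hs']
  by (destruct hs as [E|E]; injection E; auto).
exists s; split; [assumption|]; intros o i j h.
apply tF in h as (A & FA & Ad).
destruct (st A FA) as (D & AD); pose proof Ad as Ad'.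
apply AD in Ad' as [k E]; cbn [fst snd] in E.
unfold translate in E; injection E as -> -> ->.
split; apply tF; exists A; (split; [assumption|]); apply AD;
  [exists (k + 1)|exists (k - 1)]; unfold translate; cbn [fst snd dir left bottom];
  f_equal; lia.
Qed.

(** Both arrangements at once: [e] is [1] when the north tip is upper left and [0] when it is upper
    right. *)
Lemma windmill_dominoes (t : domino -> Prop) :
  is_windmill t -> exists x y e, (e = 0 \/ e = 1) /\
    (forall i j, t (Domino Vertical i j) <->
       (exists k, 0 <= k /\ j = y + Z.abs (i - (x - e)) + 2 * k) \/
       (exists k, 0 <= k /\ j = y - 2 - Z.abs (i - (x - 1 + e)) - 2 * k)) /\
    (forall i j, t (Domino Horizontal i j) <->
       (exists k, 0 <= k /\ i = x + Z.abs (j - (y - 1 + e)) + 2 * k) \/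
       (exists k, 0 <= k /\ i = x - 2 - Z.abs (j - (y - e)) - 2 * k)).
Proof.
intros (_ & x & y & [W|W]); exists x, y; [exists 1|exists 0];
  (split; [lia|]); split; intros i j;
  rewrite W, south_quadrant_iff, west_quadrant_iff;
  (split;
   [ intros [(m & k & hk & E)|[(m & k & hk & E)|[(m & k & hk & E)|(m & k & hk & E)]]];
     try discriminate E;
     pose proof (f_equal left E) as E1; pose proof (f_equal bottom E) as E2;
     cbn [left bottom] in E1, E2;
     first [left; exists k; lia | right; exists k; lia] | ]).
all: intros [(k & hk & ->)|(k & hk & ->)].
- left; exists (i - (x - 1)), k; split; [assumption|f_equal; lia].
- right; right; left; exists (i - x), k; split; [assumption|f_equal; lia].
- right; left; exists (j - y), k; split; [assumption|f_equal; lia].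
- right; right; right; exists (j - (y - 1)), k; split; [assumption|f_equal; lia].
- left; exists (i - x), k; split; [assumption|f_equal; lia].
- right; right; left; exists (i - (x - 1)), k; split; [assumption|f_equal; lia].
- right; left; exists (j - (y - 1)), k; split; [assumption|f_equal; lia].
- right; right; right; exists (j - y), k; split; [assumption|f_equal; lia].
Qed.

Theorem theorem2 (t : domino -> Prop) (Ht : is_tiling t) :
  (admits_flip t \/ consists_of_parallel_staircases t \/ is_windmill t) /\
  ~ (admits_flip t /\ consists_of_parallel_staircases t) /\
  ~ (admits_flip t /\ is_windmill t) /\
  ~ (consists_of_parallel_staircases t /\ is_windmill t).
Proof.
split; [|split; [|split]].
- destruct (classic (admits_flip t)) as [f|n]; [now left|right].
  destruct (flip_free_classified _ _ (tiling_flip_free t Ht n))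
    as [(s & hs & I)|[(a & b & P)|(a & b & P)]].
  + left; now apply (invariant_staircases t s).
  + right; now apply (pinwheel_windmill t a b).
  + right; now apply (mirror_pinwheel_windmill t a b).
- intros [f c]; apply admits_flip_iff in f as (i & j & f).
  apply staircases_translate in c as (s & hs & tr).
  destruct f as [[h h']|[h h']]; pose proof (tr _ _ _ h) as [h1 h2].
  (* A translate of the lower domino overlaps the upper one in a single cell. *)
  + assert (E : exists d, t d /\ d <> Domino Horizontal i (j + 1) /\
      (covers d i (j + 1) \/ covers d (i + 1) (j + 1))).
    { destruct hs as [-> | ->]; eexists;
        [split; [exact h1|]|split; [exact h2|]];
        (split; [intros E; injection E; lia|]);
        unfold covers; cbn [dir left bottom]; lia. }
    destruct E as (d & td & n & [c|c]); apply n;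
      [apply (tiling_unique t _ _ i (j + 1) Ht td h' c)
      |apply (tiling_unique t _ _ (i + 1) (j + 1) Ht td h' c)];
      unfold covers; cbn [dir left bottom]; lia.
  + assert (E : exists y, y <> j /\ t (Domino Vertical (i + 1) y) /\
      (y = j + 1 \/ y = j - 1)).
    { exists (j + s); repeat split; [lia|assumption|lia]. }
    destruct E as (y & n & td & E); apply n.
    enough (Q : Domino Vertical (i + 1) y = Domino Vertical (i + 1) j)
      by now injection Q.
    destruct E as [-> | ->];
      [apply (tiling_unique t _ _ (i + 1) (j + 1) Ht td h')
      |apply (tiling_unique t _ _ (i + 1) j Ht td h')];
      unfold covers; cbn [dir left bottom]; lia.
- intros [f w]; apply admits_flip_iff in f as (i & j & f).
  apply windmill_dominoes in w as (x & y & e & he & wV & wH).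
  (* Dominoes of one quadrant in adjacent rows or columns start at opposite parities, and opposite
     quadrants stay apart. *)
  destruct f as [[h h']|[h h']].
  + apply wH in h, h'.
    destruct h as [(k & hk & E)|(k & hk & E)],
      h' as [(k' & hk' & E')|(k' & hk' & E')]; lia.
  + apply wV in h, h'.
    destruct h as [(k & hk & E)|(k & hk & E)],
      h' as [(k' & hk' & E')|(k' & hk' & E')]; lia.
- (* The tip of the north quadrant has no lower neighbour. *)
  intros [c w].
  apply staircases_translate in c as (s & hs & tr).
  apply windmill_dominoes in w as (x & y & e & he & wV & _).
  assert (h : t (Domino Vertical (x - e) y)) by (apply wV; left; exists 0; lia).
  apply tr in h as [h1 h2]; apply wV in h1, h2.
  destruct hs as [-> | ->];
    [destruct h2 as [(k & hk & E)|(k & hk & E)]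
    |destruct h1 as [(k & hk & E)|(k & hk & E)]]; lia.
Qed.
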